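(* Let $g:\mathcal{Z}\to\mathcal{Z}^*$ be an operator, $r:\mathcal{Z}\to\mathbb{R}$ convex, and $\eta>0$. Assume that either $g$ is $\frac1\eta$-relatively Lipschitz with respect to $r$, or $r$ is $\eta$-area convex with respect to $g$. Then $g$ is $\frac1\eta$-relaxed relatively Lipschitz with respect to $r$.
   Context: $\mathcal{Z}$ is a convex set and $\mathcal{Z}^*$ denotes the dual space. For a differentiable convex function $r$, $V^r_x(x')=r(x')-r(x)-\langle\nabla r(x),x'-x\rangle$. Definitions (each required for all $(z,z',z^+)\in\mathcal{Z}\times\mathcal{Z}\times\mathcal{Z}$): - $g$ is $\frac1\eta$-relatively Lipschitz with respect to $r$ if $\eta\langle g(z')-g(z),z'-z^+\rangle\le V^r_z(z')+V^r_{z'}(z^+)$. - $r$ is $\eta$-area convex with respect to $g$ if, with $c=\frac13(z+z'+z^+)$, $\eta\langle g(z')-g(z),z'-z^+\rangle\le r(z)+r(z')+r(z^+)-3r(c)$. - $g$ is $\frac1\eta$-relaxed relatively Lipschitz with respect to $r$ if $\eta\langle g(z')-g(z),z'-z^+\rangle\le V^r_z(z')+V^r_{z'}(z^+)+V^r_z(z^+)$. *)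

(* Defs.v *)
From mathcomp Require Export all_boot all_order all_algebra.
From mathcomp Require Export all_classical all_reals all_analysis.
Export Order.TTheory GRing.Theory Num.Theory.
Export numFieldNormedType.Exports.

Set Implicit Arguments.
Unset Strict Implicit.
Unset Printing Implicit Defensive.

Local Open Scope classical_set_scope.
Local Open Scope ring_scope.

(* The convex set Z lives in an arbitrary real normed space V, and functions
   with domain Z are represented by functions on V whose values outside Z are
   irrelevant.  The pairing <phi, v> is the application phi v. *)

(* {linear V -> R^o} is the algebraic dual; continuity on Z puts the values of
   phi in the topological dual Z^*. *)
Definition dual_valued (R : realType) (V : normedModType R) (Z : set V)
    (phi : V -> {linear V -> R^o}) : Prop :=
  forall z, Z z -> continuous (phi z).

(* r : Z -> R is (Frechet) differentiable on Z, with gradient map nabla.  The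
   expansion is taken within Z, so Z need not be open nor have nonempty
   interior.  When Z is thin, nabla z is not unique as a functional on V, but
   for convex Z its values on the differences x - z with x in Z are, and the
   Bregman divergence only uses those. *)
Definition gradient_on (R : realType) (V : normedModType R) (Z : set V)
    (r : V -> R^o) (nabla : V -> {linear V -> R^o}) : Prop :=
  dual_valued Z nabla /\
  forall z, Z z -> forall x,
    r x = r z + nabla z (x - z) +o_(x \near within Z (nbhs z)) (x - z).

(* V^r_x(x'), with base point x first *)
Definition bregman (R : realType) (V : normedModType R)
    (r : V -> R^o) (nabla : V -> {linear V -> R^o}) (x x' : V) : R :=
  r x' - r x - nabla x (x' - x).

(* The Lipschitz constant is 1/eta, not eta; likewise for the relaxed notion. *)
Definition relatively_lipschitz (R : realType) (V : normedModType R)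
    (Z : set V) (g : V -> {linear V -> R^o})
    (r : V -> R^o) (nabla : V -> {linear V -> R^o}) (eta : R) : Prop :=
  forall z z' zp, Z z -> Z z' -> Z zp ->
    eta * (g z' \- g z) (z' - zp)
      <= bregman r nabla z z' + bregman r nabla z' zp.

Definition area_convex (R : realType) (V : normedModType R)
    (Z : set V) (g : V -> {linear V -> R^o}) (r : V -> R^o) (eta : R) : Prop :=
  forall z z' zp, Z z -> Z z' -> Z zp ->
    let c := 3^-1 *: (z + z' + zp) in
    eta * (g z' \- g z) (z' - zp) <= r z + r z' + r zp - 3 * r c.

Definition relaxed_relatively_lipschitz (R : realType) (V : normedModType R)
    (Z : set V) (g : V -> {linear V -> R^o})
    (r : V -> R^o) (nabla : V -> {linear V -> R^o}) (eta : R) : Prop :=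
  forall z z' zp, Z z -> Z z' -> Z zp ->
    eta * (g z' \- g z) (z' - zp)
      <= bregman r nabla z z' + bregman r nabla z' zp + bregman r nabla z zp.

(* Main.v *)
Require Import Defs.
From mathcomp Require Import ring lra.

Set Implicit Arguments.
Unset Strict Implicit.
Unset Printing Implicit Defensive.

(** Both parts rest on one fact: a differentiable convex function lies above
    its tangents, that is, Bregman divergences are nonnegative on [Z]
    ([bregman_ge0]).

    If [g] is relatively Lipschitz, the relaxed bound only adds the
    nonnegative term [V_z(zp)].

    If [r] is area convex, the tangent at [z] bounds [r c] from below at the
    centroid [c].  Since [3 (c - z) = (z' - z) + (zp - z)], this turns the
    area [r z + r z' + r zp - 3 r c] into at most [V_z(z') + V_z(zp)]
    ([area_le_bregman]), and the relaxed bound only adds the nonnegative term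
    [V_{z'}(zp)]. *)

Local Open Scope classical_set_scope.
Local Open Scope ring_scope.

Lemma convex_set_comb (R : realType) (V : normedModType R) (Z : set V) (t : R)
    (x y : V) :
  convex_set Z -> 0 <= t -> t <= 1 -> Z x -> Z y ->
  Z (t *: x + (1 - t) *: y).
Proof.
move=> cZ t0 t1 Zx Zy.
by have := cZ x y (Itv01 t0 t1); rewrite !inE; apply.
Qed.

Lemma convex_function_comb (R : realType) (V : normedModType R) (Z : set V)
    (r : V -> R^o) (t : R) (x y : V) :
  convex_function Z r -> 0 <= t -> t <= 1 -> Z x -> Z y ->
  r (t *: x + (1 - t) *: y) <= t * r x + (1 - t) * r y.
Proof.
move=> cr t0 t1 Zx Zy.
by have := cr (Itv01 t0 t1) x y; rewrite !inE; apply.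
Qed.

Lemma convex_set_centroid (R : realType) (V : normedModType R) (Z : set V)
    (x y z : V) :
  convex_set Z -> Z x -> Z y -> Z z -> Z (3^-1 *: (x + y + z)).
Proof.
move=> cZ Zx Zy Zz.
have -> : 3^-1 *: (x + y + z) =
    3^-1 *: x + (1 - 3^-1) *: (2^-1 *: y + (1 - 2^-1) *: z).
  by rewrite !(scalerDr, scalerA) addrA; congr (_ + _ *: _ + _ *: _); field.
by do 2?[apply: convex_set_comb => //; try lra].
Qed.

(** Along the segment [p t = x + t (x' - x)], convexity puts the increment
    [r (p t) - r x] below [t (r x' - r x)], while differentiability puts it
    above [t nabla x (x' - x) - k t |x' - x|] for small [t], whatever [k > 0].
    Dividing by such a [t > 0] compares the two slopes up to [k |x' - x|]. *)
Lemma bregman_ge0 (R : realType) (V : normedModType R) (Z : set V)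
    (r : V -> R^o) (nabla : V -> {linear V -> R^o}) (x x' : V) :
  convex_set Z -> convex_function Z r -> gradient_on Z r nabla ->
  Z x -> Z x' -> 0 <= bregman r nabla x x'.
Proof.
move=> cZ cr [_ dr] Zx Zx'; rewrite /bregman subr_ge0.
apply/ler_addgt0Pr => e e0.
(* [k] is a slope error with [k n <= e]; dividing by [n + 1] rather than [n]
   covers the case [x' = x], where [n = 0]. *)
pose n := `|x' - x|; pose k := e / (n + 1).
have n0 : 0 <= n by exact: normr_ge0.
have k0 : 0 < k by rewrite divr_gt0// ltr_wpDl.
have kn : k * n <= e.
  by rewrite /k mulrAC ler_pdivrMr ?ltr_wpDl// ler_pM2l// lerDl.
pose p (t : R) := t *: x' + (1 - t) *: x.
have pE t : p t - x = t *: (x' - x).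
  by rewrite /p scalerBl scale1r scalerBr addrA addrAC addrK.
have p_cvg : p t @[t --> 0^'+] --> x.
  apply: cvg_at_right_filter.
  have -> : x = p 0 by rewrite /p scale0r add0r subr0 scale1r.
  apply: cvgD; apply: cvgZr_tmp.
    exact: cvg_id.
  by apply: cvgB; [exact: cvg_cst|exact: cvg_id].
have /p_cvg near_p : nbhs x (fun y => Z y ->
    `|r y - (r x + nabla x (y - x))| <= k * `|y - x|).
  (* The little-o remainder is given as a term that mentions [r] and [nabla];
     only its order matters, so it is abstracted as [q]. *)
  have [q qE] : exists q : {o_ (within Z (nbhs x)) (fun y => y - x)},
      forall y, r y = r x + nabla x (y - x) + q y.
    by eexists => y; exact: dr.
  have : \forall y \near within Z (nbhs x), `|q y| <= k * `|y - x|.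
    exact: littleoP.
  rewrite near_withinE; apply: filterS => y qy Zy.
  by rewrite qE [X in X - _]addrC addrK; exact: qy.
near (0 : R)^'+ => t.
have t0 : 0 < t by near: t; exact: nbhs_right_gt.
have t1 : t <= 1 by near: t; exact: nbhs_right_le.
have Zp : Z (p t) by apply: convex_set_comb => //; exact: ltW.
have : `|r (p t) - (r x + nabla x (p t - x))| <= k * `|p t - x|.
  by move: Zp; near: t; exact: near_p.
rewrite pE linearZ /= normrZ (gtr0_norm t0) -/n => /ler_normlP[+ _].
have := convex_function_comb cr (ltW t0) t1 Zx' Zx.
rewrite -/(p t) => convp tangp; rewrite -(ler_pM2l t0).
have := ler_wpM2l (ltW t0) kn; move: tangp; rewrite /GRing.scale/=.
lra.
Unshelve. all: by end_near.
Qed.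

(** This is the tangent inequality [0 <= V_z(c)] at the centroid [c], times 3:
    in fact [V_z(z') + V_z(zp)] minus the area is exactly [3 V_z(c)]. *)
Lemma area_le_bregman (R : realType) (V : normedModType R) (Z : set V)
    (r : V -> R^o) (nabla : V -> {linear V -> R^o}) (z z' zp : V) :
  convex_set Z -> convex_function Z r -> gradient_on Z r nabla ->
  Z z -> Z z' -> Z zp ->
  r z + r z' + r zp - 3 * r (3^-1 *: (z + z' + zp))
    <= bregman r nabla z z' + bregman r nabla z zp.
Proof.
move=> cZ cr dr Zz Zz' Zzp.
have := bregman_ge0 cZ cr dr Zz (convex_set_centroid cZ Zz Zz' Zzp).
rewrite /bregman.
have -> : 3^-1 *: (z + z' + zp) - z = 3^-1 *: ((z' - z) + (zp - z)).
  have {2}-> : z = 3^-1 *: (z + z + z).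
    rewrite -mulr2n -mulrSr -(scaler_nat 3 z) scalerA.
    by rewrite mulVf ?scale1r// pnatr_eq0.
  rewrite -scalerBr; congr (_ *: _).
  by rewrite !opprD addrACA (addrACA z z') subrr add0r.
rewrite linearZ /= (linearD (nabla z)) /GRing.scale/=.
lra.
Qed.

Theorem lemma17 (R : realType) (V : normedModType R) (Z : set V)
    (g : V -> {linear V -> R^o}) (r : V -> R^o)
    (nabla : V -> {linear V -> R^o}) (eta : R) :
  convex_set Z ->
  dual_valued Z g ->
  convex_function Z r ->
  gradient_on Z r nabla ->
  0 < eta ->
  relatively_lipschitz Z g r nabla eta \/ area_convex Z g r eta ->
  relaxed_relatively_lipschitz Z g r nabla eta.
Proof.
move=> cZ _ cr dr _ [lip|area] z z' zp Zz Zz' Zzp.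
  by apply: (le_trans (lip _ _ _ Zz Zz' Zzp)); rewrite lerDl (bregman_ge0 cZ).
apply: (le_trans (area _ _ _ Zz Zz' Zzp)).
apply: (le_trans (area_le_bregman cZ cr dr Zz Zz' Zzp)).
by rewrite lerD2r lerDl (bregman_ge0 cZ).
Qed.
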